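(* Suppose $np \to \infty$ and $d < 0.99n$. Then there is a $d$-dependent random graph distribution $G_{n,p,d}$ such that, for $G$ drawn from it, almost surely there are sets of vertices $A$ and $B$ where \[ e(A,B) - p|A||B| > (1-o(1))(1-p)\sqrt{1-d/n}\,\sqrt{|A||B|\,np\,(d+1)}. \]
   Context: A dependency graph for a set of random variables $X_1,\ldots,X_m$ is a graph whose vertices correspond to the random variables and whose edges correspond to dependencies: each $X_i$ is independent of the collection of all other $X_j$ except those for which $(i,j)$ is an edge (the notion used in the Lovász local lemma and Janson's inequality). The variables are $d$-locally dependent if they have a dependency graph of maximum degree at most $d$. A $d$-dependent random graph distribution $G_{n,p,d}$ is any random graph distribution on $n$ vertices in which each edge is present with probability $p$ and the edges (that is, their indicator variables) are $d$-locally dependent. The parameters $p$ and $d$ may depend on $n$. An event happens almost surely if its probability tends to $1$ as $n\to\infty$, and $o(1)$ denotes a quantity tending to $0$ as $n\to\infty$. For sets of vertices $A,B$ (not necessarily disjoint), $e(A,B)$ counts the number of edges of $G$ having one endpoint in $A$ and the other in $B$, with edges contained in $A\cap B$ counted twice.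
   Formalization: The edge probability is assumed to satisfy p < 1; for p = 1 the graph is almost surely complete, so e(A,B) - p|A||B| ≤ 0 while the right-hand side is 0, and the strict inequality fails. *)

(* Defs.v *)
From HB Require Import structures.
From mathcomp Require Import all_boot all_order all_algebra.
From mathcomp Require Import all_classical all_reals all_analysis.

Set Implicit Arguments.
Unset Strict Implicit.
Unset Printing Implicit Defensive.

Import Order.TTheory GRing.Theory Num.Theory.
Import numFieldNormedType.Exports.

Local Open Scope classical_set_scope.
Local Open Scope ring_scope.

(* A simple graph on 'I_n is identified with its set of edges, and an edge with
   the pair of its endpoints: a two-element set, hence no loops or multi-edges. *)
Definition edge (n : nat) := {e : {set 'I_n} | #|e| == 2%N}.
HB.instance Definition _ n := Finite.on (edge n).

Definition sgraph (n : nat) := {set edge n}.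
HB.instance Definition _ n := Finite.on (sgraph n).
HB.instance Definition _ n := isPointed.Build (sgraph n) (finset.set0 : {set edge n}).

HB.instance Definition _ n := @isMeasurable.Build default_measure_display
  (sgraph n) discrete_measurable discrete_measurable0
  discrete_measurableC discrete_measurableU.

Definition joins (n : nat) (e : edge n) (A B : {set 'I_n}) : bool :=
  [exists a in A, exists b in B, val e == [set a; b]%SET].

(* Edges inside A :&: B are counted by both terms, hence twice. *)
Definition edge_count (n : nat) (G : sgraph n) (A B : {set 'I_n}) : nat :=
  (#|[set e : edge n | (e \in G) && joins e A B]%SET|
   + #|[set e : edge n | (e \in G) && (val e \subset A :&: B)]%SET|)%N.

Definition edge_indicator (n : nat) (e : edge n) (G : sgraph n) : bool := e \in G.

Lemma measurable_edge_indicator (n : nat) (e : edge n) :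
  measurable_fun setT (edge_indicator e).
Proof. by []. Qed.

HB.instance Definition _ (n : nat) (e : edge n) :=
  isMeasurableFun.Build _ _ (sgraph n) bool (edge_indicator e)
    (@measurable_edge_indicator n e).

Definition independent_systems d (T : measurableType d) (R : realType)
    (P : probability T R) (F G : set_system T) : Prop :=
  forall U V : set T, F U -> G V -> P (U `&` V) = (P U * P V)%E.

(* The sigma-algebra on T generated by the subfamily of variables X j, j in J. *)
Definition g_sigma_family d d' (T : measurableType d) (T' : measurableType d')
    (R : realType) (P : probability T R) (I : Type) (X : I -> {RV P >-> T'})
    (J : set I) : set_system T :=
  <<s \bigcup_(j in J) g_sigma_algebra_preimage (X j) >>.

(* Independence of the collection is joint, not pairwise: X i is independent of
   the sigma-algebra generated by all the non-neighbours of i together. *)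
Definition dependency_graph d d' (T : measurableType d) (T' : measurableType d')
    (R : realType) (P : probability T R) (I : finType) (X : I -> {RV P >-> T'})
    (D : rel I) : Prop :=
  [/\ symmetric D, irreflexive D &
      forall i : I, independent_systems P
        (g_sigma_algebra_preimage (X i))
        (g_sigma_family X [set j | j != i /\ ~~ D i j])].

Definition locally_dependent d d' (T : measurableType d) (T' : measurableType d')
    (R : realType) (P : probability T R) (I : finType) (X : I -> {RV P >-> T'})
    (k : nat) : Prop :=
  exists2 D : rel I, dependency_graph X D &
    forall i : I, (#|[set j | D i j]%SET| <= k)%N.

Definition dependent_random_graph (R : realType) (n : nat) (p : R) (d : nat)
    (P : probability (sgraph n) R) : Prop :=
  (forall e : edge n, P [set G | edge_indicator e G] = p%:E) /\
  locally_dependent (fun e : edge n => edge_indicator e : {RV P >-> bool}) d.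

(* Main.v *)
(* Fix a set A of d + 1 vertices. Every vertex v outside A gets one coin of bias
   p that decides all d + 1 edges from v to A at once; every other edge gets a
   coin of its own. Each edge then shares its coin with at most d others. If B is
   the set of vertices v whose coin came up, then e(A, B) - p|A||B| equals
   (1 - p)(d + 1)|B|, where |B| is binomial with mean (n - d - 1)p -> oo. Hence
   |B| ~ (n - d)p by Chebyshev, and the deviation is asymptotically
   (1 - p)(d + 1) sqrt(|B|(n - d)p), which is the claimed bound. *)
Require Import Defs.
From HB Require Import structures.
From mathcomp Require Import all_boot all_order all_algebra.
From mathcomp Require Import all_classical all_reals all_analysis.
From mathcomp Require Import ring lra.

Set Implicit Arguments.
Unset Strict Implicit.
Unset Printing Implicit Defensive.

Import Order.TTheory GRing.Theory Num.Theory.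
Import numFieldNormedType.Exports.

Local Open Scope classical_set_scope.
Local Open Scope ring_scope.

(** * Independent coins of bias [p], and finitely supported probability measures *)

Definition bernoulli_weight (R : realType) (K : finType) (p : R)
  (x : {ffun K -> bool}) : R := \prod_k (if x k then p else 1 - p).

Definition bernoulli_mean (R : realType) (K : finType) (p : R)
  (f : {ffun K -> bool} -> R) : R := \sum_x bernoulli_weight p x * f x.

Definition set_coord (K : finType) (k : K) (b : bool) (x : {ffun K -> bool}) :=
  [ffun l => if l == k then b else x l].

Lemma bernoulli_weight_ge0 (R : realType) (K : finType) (p : R)
    (x : {ffun K -> bool}) : 0 <= p <= 1 -> 0 <= bernoulli_weight p x.
Proof.
by move=> /andP[p0 p1]; apply: prodr_ge0 => k _; case: (x k); rewrite ?subr_ge0.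
Qed.

Lemma bernoulli_weight_sum (R : realType) (K : finType) (p : R) :
  \sum_(x : {ffun K -> bool}) bernoulli_weight p x = 1.
Proof.
rewrite -(bigA_distr_bigA (fun (_ : K) (b : bool) => if b then p else 1 - p)).
by rewrite big1// => k _; rewrite big_bool/=; ring.
Qed.

Lemma bernoulli_mean_cst (R : realType) (K : finType) (p c : R) :
  bernoulli_mean p (fun _ : {ffun K -> bool} => c) = c.
Proof. by rewrite /bernoulli_mean -mulr_suml bernoulli_weight_sum mul1r. Qed.

Lemma bernoulli_meanZ (R : realType) (K : finType) (p c : R)
    (f : {ffun K -> bool} -> R) :
  bernoulli_mean p (fun x => c * f x) = c * bernoulli_mean p f.
Proof. by rewrite /bernoulli_mean mulr_sumr; apply: eq_bigr => x _; ring. Qed.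

Lemma bernoulli_meanB (R : realType) (K : finType) (p : R)
    (f g : {ffun K -> bool} -> R) :
  bernoulli_mean p (fun x => f x - g x) = bernoulli_mean p f - bernoulli_mean p g.
Proof. by rewrite -sumrB; apply: eq_bigr => x _; ring. Qed.

Lemma bernoulli_mean_sum (R : realType) (K I : finType) (A : pred I) (p : R)
    (f : I -> {ffun K -> bool} -> R) :
  bernoulli_mean p (fun x => \sum_(i | A i) f i x) =
  \sum_(i | A i) bernoulli_mean p (f i).
Proof.
by rewrite exchange_big/=; apply: eq_bigr => x _; rewrite mulr_sumr.
Qed.

Lemma ler_bernoulli_mean (R : realType) (K : finType) (p : R)
    (f g : {ffun K -> bool} -> R) :
  0 <= p <= 1 -> (forall x, f x <= g x) ->
  bernoulli_mean p f <= bernoulli_mean p g.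
Proof.
move=> p01 fg; apply: ler_sum => x _.
by apply: ler_wpM2l => //; exact: bernoulli_weight_ge0.
Qed.

(* Configurations are summed in pairs that differ only at coordinate k. *)
Lemma bernoulli_mean_set_coord (R : realType) (K : finType) (p : R) (k : K)
    (f : {ffun K -> bool} -> R) :
  bernoulli_mean p f =
  bernoulli_mean p (fun x => p * f (set_coord k true x) +
                             (1 - p) * f (set_coord k false x)).
Proof.
pose w (x : {ffun K -> bool}) := \prod_(l | l != k) (if x l then p else 1 - p).
have wE x : bernoulli_weight p x = (if x k then p else 1 - p) * w x.
  by rewrite /bernoulli_weight (bigD1 k).
have pair h : bernoulli_mean p h =
    \sum_(x : {ffun K -> bool} | x k) w x * (p * h (set_coord k true x) +
                          (1 - p) * h (set_coord k false x)).
  rewrite /bernoulli_mean (bigID (fun x : {ffun K -> bool} => x k))/=.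
  rewrite [X in _ + X](reindex_onto (set_coord k false) (set_coord k true)) /=.
    rewrite [X in _ + X](eq_bigl (fun x : {ffun K -> bool} => x k)); last first.
      move=> x; rewrite ffunE eqxx/=; apply/eqP/idP => [<-|xk].
        by rewrite ffunE eqxx.
      by apply/ffunP => l; rewrite !ffunE; case: eqP => // ->.
    rewrite -big_split/=; apply: eq_bigr => x xk.
    have wS : w (set_coord k false x) = w x.
      by apply: eq_bigr => l /negbTE lk; rewrite ffunE lk.
    have -> : set_coord k true x = x.
      by apply/ffunP => l; rewrite !ffunE; case: eqP => // ->.
    by rewrite !wE wS xk ffunE eqxx; ring.
  move=> x xk; apply/ffunP => l; rewrite !ffunE; case: eqP => // ->.
  by rewrite (negbTE xk).
(* With [pair] applied to both sides, the inner resets of [k] on the right collapse, and the outer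
   weights [p] and [1 - p] add up to 1. *)
rewrite !pair; apply: eq_bigr => x xk; congr (_ * _).
have ss b c : set_coord k b (set_coord k c x) = set_coord k b x.
  by apply/ffunP => l; rewrite !ffunE; case: eqP.
by rewrite !ss; ring.
Qed.

(** Since [g] ignores coordinate [k], averaging over that coin alone factors [u] out. Both the
    vanishing of covariances and the independence of a graph edge from its non-neighbours rest on
    this. *)
Lemma bernoulli_mean_indep (R : realType) (K : finType) (p : R) (k : K)
    (u : bool -> R) (g : {ffun K -> bool} -> R) :
  (forall b x, g (set_coord k b x) = g x) ->
  bernoulli_mean p (fun x => u (x k) * g x) =
  (p * u true + (1 - p) * u false) * bernoulli_mean p g.
Proof.
move=> gk; rewrite (bernoulli_mean_set_coord p k) -bernoulli_meanZ.
by apply: eq_bigr => x _; rewrite !gk !ffunE eqxx; ring.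
Qed.

Lemma bernoulli_mean_coord (R : realType) (K : finType) (p : R) (k : K)
    (u : bool -> R) :
  bernoulli_mean p (fun x : {ffun K -> bool} => u (x k)) =
  p * u true + (1 - p) * u false.
Proof.
rewrite -[RHS]mulr1 -[X in _ * X](bernoulli_mean_cst K p 1).
by rewrite -(bernoulli_mean_indep p (k := k))//; apply: eq_bigr => x _; rewrite mulr1.
Qed.

Lemma bernoulli_variance (R : realType) (K : finType) (p : R) (A : {set K}) :
  bernoulli_mean p (fun x => (\sum_(k in A) ((x k)%:R - p)) ^+ 2) =
  #|A|%:R * (p * (1 - p)).
Proof.
have -> : (fun x : {ffun K -> bool} => (\sum_(k in A) ((x k)%:R - p)) ^+ 2) =
    fun x => \sum_(k in A) \sum_(l in A) ((x k)%:R - p) * ((x l)%:R - p).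
  apply/funext => x; rewrite expr2 mulr_suml.
  by apply: eq_bigr => k _; rewrite mulr_sumr.
rewrite bernoulli_mean_sum -mulr_natl mulr1 -sumr_const mulr_suml.
(* A diagonal term contributes [p * (1 - p)]. Off the diagonal, the centred coin at [k] factors out
   with mean 0. *)
apply: eq_bigr => k kA; rewrite bernoulli_mean_sum (bigD1 k)//= big1.
  by rewrite (bernoulli_mean_coord p k (fun b => (b%:R - p) * (b%:R - p))) /=; ring.
move=> l /andP[_ lk].
rewrite (bernoulli_mean_indep p (k := k) (fun b => b%:R - p)) /=; first by ring.
by move=> b x; rewrite ffunE (negbTE lk).
Qed.

Lemma bernoulli_chebyshev (R : realType) (K : finType) (p t : R) (A : {set K}) :
  0 <= p <= 1 -> 0 < t ->
  1 - #|A|%:R * p / t ^+ 2 <=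
  bernoulli_mean p
    (fun x => (p * #|A|%:R - t < #|[set k in A | x k]%SET|%:R)%R%:R).
Proof.
move=> p01 t0; rewrite lerBlDl -lerBlDr.
rewrite -[X in X - _ <= _](bernoulli_mean_cst K p 1) -bernoulli_meanB.
(* The failure indicator is dominated pointwise by the squared deviation over [t ^+ 2]. The variance
   factor [p * (1 - p)] is then relaxed to [p]. *)
apply: (@le_trans _ _ (t ^- 2 * (#|A|%:R * (p * (1 - p))))); last first.
  rewrite mulrC ler_pM2r ?invr_gt0 ?exprn_gt0// ler_wpM2l//.
  by case/andP: p01 => p0 p1; nra.
rewrite -bernoulli_variance -bernoulli_meanZ; apply: ler_bernoulli_mean => // x.
have -> : \sum_(k in A) ((x k)%:R - p) =
    #|[set k in A | x k]%SET|%:R - p * #|A|%:R.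
  rewrite sumrB sumr_const -[p *+ _]mulr_natr; congr (_ - _).
  rewrite -sum1_card natr_sum big_mkcond [RHS]big_mkcond/=.
  by apply: eq_bigr => k _; rewrite inE; case: (k \in A) => //=; case: (x k).
set b := #|[set k in A | x k]%SET|%:R; case: (ltP (_ - t) b) => /= h.
  by rewrite subrr mulr_ge0// ?sqr_ge0// invr_ge0 sqr_ge0.
rewrite subr0 mulrC ler_pdivlMr ?exprn_gt0// mul1r.
by rewrite -[(b - _) ^+ 2]sqrrN lerXn2r ?nnegrE; lra.
Qed.

(** This is the pushforward of the weights [w] along [f], built as a finite sum of scaled Dirac
    masses so that [T] itself needs no measurable structure. *)
Lemma finite_probability (R : realType) (T : finType) (w : T -> R)
    (disp : measure_display) (U : measurableType disp) (f : T -> U) :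
  (forall x, 0 <= w x) -> \sum_x w x = 1 ->
  exists P : probability U R, forall S, P S = (\sum_x w x * \1_S (f x))%:E.
Proof.
move=> w0 w1.
have [x0 _|T0] := pickP (@predT T); last first.
  by move: w1; rewrite big_pred0// => /esym/eqP; rewrite oner_eq0.
pose y k := nth x0 (enum T) k.
pose m k := mscale (NngNum (w0 (y k))) (dirac (f (y k))) : {measure set U -> \bar R}.
have [mu muE] : exists mu : {measure set U -> \bar R},
    forall S, mu S = (\sum_x w x * \1_S (f x))%:E.
  exists (msum m #|T|) => S.
  rewrite /= /msum -sumEFin [RHS](reindex_onto enum_val enum_rank) /=; last first.
    by move=> x _; rewrite enum_rankK.
  rewrite [RHS](eq_bigl predT) => [|i]; last by rewrite enum_valK eqxx.
  apply: eq_bigr => i _; rewrite /m /y -(enum_val_nth x0).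
  by rewrite /= /mscale/= diracE -EFinM indicE.
have muT : mu setT = 1%E.
  rewrite muE; congr EFin; rewrite -[RHS]w1; apply: eq_bigr => x _.
  by rewrite indicT mulr1.
(* The total mass is already 1, so normalizing leaves [mu] unchanged and only supplies the
   probability structure; the Dirac fallback never applies. *)
exists (mnormalize mu (dirac (f x0))) => S.
by rewrite -muE /= /mnormalize muT onee_eq0/= invr1 mule1.
Qed.

(** * The random graph with bundled edges *)

(* Edges get independent coins indexed by sets of vertices: the edge from a in A
   to v outside A uses the coin [set v], any other edge e uses the coin e. *)
Definition bundle (n : nat) (A : {set 'I_n}) (e : edge n) : {set 'I_n} :=
  if #|val e :&: A| == 1%N then val e :\: A else val e.

Definition bundle_graph (n : nat) (A : {set 'I_n})
  (x : {ffun {set 'I_n} -> bool}) : sgraph n := [set e | x (bundle A e)]%SET.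

(** The size of a coin's index reveals the kind of edge, so an edge with exactly one end in [A]
    never shares a coin with an edge of the other kind. *)
Lemma card_bundle (n : nat) (A : {set 'I_n}) (e : edge n) :
  #|bundle A e| = if #|val e :&: A| == 1%N then 1%N else 2%N.
Proof.
have /eqP e2 : #|val e| == 2%N := valP e.
by rewrite /bundle; case: eqP => // e1; rewrite cardsD e2 e1.
Qed.

(** An edge with exactly one end in [A] is recovered from its coin by adding that end, which leaves
    at most [#|A|] choices. Any other edge is its own coin, hence the 1 in the maximum. *)
Lemma card_same_bundle (n : nat) (A : {set 'I_n}) (e : edge n) :
  (#|[set e' | bundle A e' == bundle A e]%SET| <= maxn 1 #|A|)%N.
Proof.
rewrite -(card_imset _ val_inj).
case: (eqVneq #|val e :&: A| 1%N) => he.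
  apply: leq_trans (leq_maxr _ _).
  apply: leq_trans (leq_imset_card (fun a => a |: bundle A e) (mem A)).
  apply/subset_leq_card/fintype.subsetP => _ /imsetP[e' + ->].
  rewrite inE => /eqP bb; have := card_bundle A e'.
  rewrite bb card_bundle he eqxx; case: eqP => // he' _.
  have /cards1P[a ea] : #|val e' :&: A| == 1%N by rewrite he'.
  apply/imsetP; exists a; first by have := set11 a; rewrite -ea inE => /andP[].
  by rewrite -bb /bundle he' eqxx -ea finset.setID.
apply: leq_trans (leq_maxl _ _); apply: (@leq_trans #|[set val e]%SET|); last first.
  by rewrite cards1.
apply/subset_leq_card/fintype.subsetP => _ /imsetP[e' + ->].
rewrite !inE => /eqP bb; have := card_bundle A e'.
rewrite bb card_bundle (negbTE he); case: eqP => // he' _.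
by move: bb; rewrite /bundle (negbTE he); case: eqP he' => // _ _ ->.
Qed.

Lemma bundle_graph_dependent (R : realType) (n d : nat) (p : R)
    (A : {set 'I_n}) (P : probability (sgraph n) R) :
  (#|A| <= d.+1)%N ->
  (forall S, P S = (bernoulli_mean p (fun x => \1_S (bundle_graph A x)))%:E) ->
  dependent_random_graph p d P.
Proof.
move=> Ad PE; split=> [e|].
  rewrite PE; congr EFin.
  transitivity (bernoulli_mean p
    (fun x : {ffun {set 'I_n} -> bool} => (x (bundle A e))%:R : R)).
    apply: eq_bigr => x _; rewrite indicE; congr (_ * _%:R); congr nat_of_bool.
    by apply/idP/idP; rewrite inE/= /edge_indicator inE.
  by rewrite (bernoulli_mean_coord p (bundle A e) (fun b : bool => b%:R : R)) /=; ring.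
(* Neighbours are the distinct edges sharing a coin; excluding [e] itself lowers the bound from
   [d.+1] to [d]. *)
exists (fun e e' => (e != e') && (bundle A e == bundle A e')); last first.
  move=> e; have := card_same_bundle A e.
  rewrite (cardsD1 e) inE eqxx /= add1n => h.
  have /(leq_trans h) : (maxn 1 #|A| <= d.+1)%N by rewrite geq_max.
  rewrite ltnS; apply: leq_trans; apply/subset_leq_card/fintype.subsetP => e'.
  by rewrite !inE eq_sym [bundle A e == _]eq_sym.
split=> [e e'|e|e U V].
- by rewrite eq_sym [bundle A e == _]eq_sym.
- by rewrite eqxx.
move=> [B _ <-] sV; rewrite setTI.
(* Events unaffected by resetting the coin of [e] form a sigma-algebra. It contains the generators,
   because a non-neighbour of [e] uses a different coin. *)
have {sV} Vk b x : V (bundle_graph A (set_coord (bundle A e) b x)) =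
    V (bundle_graph A x).
  move: sV b x; rewrite /g_sigma_family.
  apply: (@smallest_sub _ _ _ [set V | forall b x,
    V (bundle_graph A (set_coord (bundle A e) b x)) = V (bundle_graph A x)]).
    split=> [b x //|W hW b x|W hW b x].
      by rewrite /setD/= hW.
    by apply/propext; split=> -[i _ Wi]; exists i => //; move: Wi;
      rewrite hW.
  move=> W [e' [/= e'e De] [C _ <-]] b x.
  rewrite setTI /preimage/= /edge_indicator !inE ffunE.
  by case: eqP => // be; move: De; rewrite eq_sym e'e be eqxx.
pose u b : R := \1_B b.
have UE x : \1_(edge_indicator e @^-1` B) (bundle_graph A x) = u (x (bundle A e)).
  rewrite /u !indicE; congr (_%:R); congr nat_of_bool.
  by apply/idP/idP; rewrite !inE /= /edge_indicator inE.
rewrite !PE -EFinM; congr EFin.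
transitivity (bernoulli_mean p
  (fun x => u (x (bundle A e)) * \1_V (bundle_graph A x))).
  by apply: eq_bigr => x _; rewrite indicI/= UE.
rewrite bernoulli_mean_indep; last first.
  move=> b x; rewrite !indicE; congr (_%:R); congr nat_of_bool.
  by apply/idP/idP; rewrite !inE Vk.
congr (_ * _); rewrite -(bernoulli_mean_coord p (bundle A e) u).
by apply: eq_bigr => x _; rewrite UE.
Qed.

Lemma bundle_graph_edge_count (n : nat) (A : {set 'I_n})
    (x : {ffun {set 'I_n} -> bool}) (B : {set 'I_n}) :
  (forall v, v \in B -> v \notin A) -> (forall v, v \in B -> x [set v]%SET) ->
  (#|A| * #|B| <= edge_count (bundle_graph A x) A B)%N.
Proof.
move=> AB xB; apply: leq_trans (leq_addr _ _).
rewrite -(card_imset _ val_inj) -cardsX.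
have nAB a b : a \in A -> b \in B -> a != b.
  by move=> aA bB; apply: contraTneq aA => ->; exact: AB.
have setIA a b : a \in A -> b \in B -> [set a; b]%SET :&: A = [set a]%SET.
  move=> aA bB; apply/setP => c; rewrite !inE.
  case: (eqVneq c a) => [->|_]; first by rewrite aA.
  by case: (eqVneq c b) => [->|//]; rewrite (negbTE (AB b bB)).
have setDA a b : a \in A -> b \in B -> [set a; b]%SET :\: A = [set b]%SET.
  move=> aA bB; apply/setP => c; rewrite !inE.
  case: (eqVneq c a) => [->|_]; first by rewrite aA (negbTE (nAB _ _ aA bB)).
  by case: (eqVneq c b) => [->|]; rewrite ?andbF// (negbTE (AB b bB)).
rewrite -(card_in_imset (f := fun c : 'I_n * 'I_n => [set c.1; c.2]%SET)).
  apply/subset_leq_card/fintype.subsetP => _ /imsetP[[a b] /setXP[aA bB] ->] /=.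
  have e2 : #|[set a; b]%SET| == 2%N by rewrite cards2 nAB.
  apply/imsetP; exists (exist _ [set a; b]%SET e2) => //.
  rewrite inE inE /bundle /= setIA// setDA// cards1 eqxx xB//=.
  by apply/existsP; exists a; rewrite aA; apply/existsP; exists b; rewrite bB/=.
move=> [a b] [a' b'] /setXP[aA bB] /setXP[aA' bB'] /= E.
have := setIA _ _ aA bB; rewrite E setIA// => /set1_inj ->.
by have := setDA _ _ aA bB; rewrite E setDA// => /set1_inj ->.
Qed.

Lemma card_ord_lt (n m : nat) : #|[set i : 'I_n | (i < m)%N]%SET| = minn m n.
Proof.
have -> : [set i : 'I_n | (i < m)%N]%SET =
    [set widen_ord (geq_minr m n) i | i : 'I_(minn m n)]%SET.
  apply/setP => i; rewrite inE; apply/idP/imsetP => [im|[j _ ->]]/=.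
    have h : (i < minn m n)%N by rewrite leq_min im ltn_ord.
    by exists (Ordinal h) => //; exact: val_inj.
  exact: leq_trans (ltn_ord j) (geq_minl m n).
rewrite card_imset ?card_ord// => i j /(congr1 val)/= ij; exact: val_inj.
Qed.

(** The measure is fixed before [t], so the deviation can be chosen later. If [n <= d], the set [A]
    below is the whole vertex set; local dependence still holds, and only the tail bound asks for
    [d < n]. *)
Lemma bundle_graph_exists (R : realType) (n d : nat) (p : R) : 0 <= p <= 1 ->
  exists2 P : probability (sgraph n) R, dependent_random_graph p d P &
    (d < n)%N -> forall t : R, 0 < t ->
    ((1 - (n - d.+1)%:R * p / t ^+ 2)%:E <=
      P [set G : sgraph n | exists A B : {set 'I_n},
           [/\ #|A| = d.+1, (p * (n - d.+1)%:R - t < #|B|%:R)%R &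
               (#|A| * #|B| <= edge_count G A B)%N]])%E.
Proof.
move=> p01; set A := [set i : 'I_n | (i < d.+1)%N]%SET.
have [P PE] := finite_probability (bundle_graph A)
  (fun x => bernoulli_weight_ge0 x p01) (bernoulli_weight_sum _ p).
exists P => [|dn t t0].
  by apply: (@bundle_graph_dependent _ _ _ _ A) => //; rewrite card_ord_lt geq_minl.
have cA : #|A| = d.+1 by rewrite card_ord_lt; apply/minn_idPl.
have cC : #|~: A| = (n - d.+1)%N by rewrite cardsCs finset.setCK card_ord cA.
(* Chebyshev is applied to coins, which are indexed by sets: the relevant ones are the singletons of
   vertices outside [A]. *)
pose S := [set [set v]%SET | v in ~: A]%SET.
have cS : #|S| = (n - d.+1)%N by rewrite card_imset//; exact: set1_inj.
rewrite PE lee_fin -cS; apply: le_trans (bernoulli_chebyshev S p01 t0) _.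
apply: ler_bernoulli_mean => // x; case: ltP => /= [h|_]; last first.
  by rewrite indicE ler0n.
rewrite indicE mem_set//=.
pose B := [set v in ~: A | x [set v]%SET]%SET.
have SB : [set k in S | x k]%SET = [set [set v]%SET | v in B]%SET.
  apply/setP => k; rewrite inE; apply/andP/imsetP => [[/imsetP[v vA ->] xv]|[v]].
    by exists v => //; rewrite inE vA.
  by rewrite inE => /andP[vA xv] ->; split=> //; exact: imset_f.
exists A, B; split=> //.
  by move: h; rewrite SB cS card_imset//; exact: set1_inj.
apply: bundle_graph_edge_count => v; rewrite inE => /andP[] //.
by rewrite inE.
Qed.

(** * Real estimates and passage to the limit *)

(* N, D, q, b, e stand for n, d, p, |B|, e(A, B), with |A| = D + 1; Chebyshev is
   applied with deviation s ^+ 3, between the standard deviation (at most s ^+ 2)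
   and the mean (about s ^+ 4). *)
Lemma deviation_bound (R : realType) (N D q s b e : R) :
  0 <= D -> D < N -> 0 <= q < 1 -> 2 <= s -> s ^+ 4 = (N - D) * q ->
  q * (N - (D + 1)) - s ^+ 3 < b -> (D + 1) * b <= e ->
  (1 - 2 / s) * (1 - q) * Num.sqrt (1 - D / N) *
    Num.sqrt ((D + 1) * b * (N * q) * (D + 1)) < e - q * (D + 1) * b.
Proof.
move=> D0 DN /andP[q0 q1] s2 sM hb he.
have N0 : 0 < N by lra.
have s0 : 0 < s by lra.
set r := 1 - 2 / s.
have r0 : 0 <= r by rewrite subr_ge0 ler_pdivrMr//; lra.
have r1 : r <= 1 by rewrite gerBl divr_ge0//; lra.
(* The mean is [s ^+ 4 - q], and [q < 1 <= s ^+ 3]. So the loss is below [2 * s ^+ 3], which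
   explains the 2 in [r]. *)
have rb : r * s ^+ 4 < b.
  apply: le_lt_trans hb.
  have -> : r * s ^+ 4 = s ^+ 4 - 2 * s ^+ 3 by rewrite /r; field; lra.
  have : 1 <= s ^+ 3 by rewrite exprn_ege1//; lra.
  by rewrite sM; nra.
have s40 : 0 < s ^+ 4 by rewrite exprn_gt0.
have b0 : 0 < b by apply: le_lt_trans rb; rewrite mulr_ge0// ltW.
(* The factor [1 - D / N] turns [N * q] into [(N - D) * q], that is [s ^+ 4]. *)
have -> : r * (1 - q) * Num.sqrt (1 - D / N) *
    Num.sqrt ((D + 1) * b * (N * q) * (D + 1)) =
    (1 - q) * (D + 1) * (r * Num.sqrt (b * s ^+ 4)).
  rewrite -mulrA -sqrtrM; last by rewrite subr_ge0 ler_pdivrMr//; lra.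
  have -> : (1 - D / N) * ((D + 1) * b * (N * q) * (D + 1)) =
      (D + 1) ^+ 2 * (b * s ^+ 4) by rewrite sM; field; lra.
  rewrite sqrtrM ?sqr_ge0// sqrtr_sqr ger0_norm; last lra.
  by ring.
apply: (@lt_le_trans _ _ ((1 - q) * (D + 1) * b)); last by nra.
rewrite ltr_pM2l; last by rewrite mulr_gt0//; lra.
(* After squaring and cancelling [b], the claim follows from
   [r * (r * s ^+ 4) <= r * s ^+ 4 < b]. *)
rewrite -(@ltr_pXn2r _ 2)// ?nnegrE ?mulr_ge0 ?sqrtr_ge0 ?(ltW b0)//.
rewrite exprMn sqr_sqrtr; last by rewrite mulr_ge0 ?ltW.
have -> : r ^+ 2 * (b * s ^+ 4) = b * (r * (r * s ^+ 4)) by ring.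
rewrite expr2 ltr_pM2l//; apply: le_lt_trans rb.
by rewrite ler_piMl// mulr_ge0// ltW.
Qed.

Lemma cvgr_sqrt_pinfty (R : realType) (u : nat -> R) :
  u n @[n --> \oo] --> +oo -> Num.sqrt (u n) @[n --> \oo] --> +oo.
Proof.
move=> /cvgryPge uoo; apply/cvgryPge => B.
apply: filterS (uoo (B ^+ 2)) => n Bu.
apply: le_trans (ler_norm B) _; rewrite -sqrtr_sqr; exact: ler_wsqrtr.
Qed.

Theorem theorem4 (R : realType) (p : nat -> R) (d : nat -> nat)
    (p01 : forall n : nat, 0 <= p n < 1)
    (np_oo : n%:R * p n @[n --> \oo] --> +oo)
    (d_lt : forall n : nat, (0 < n)%N -> (d n)%:R < 99%:R / 100%:R * n%:R :> R) :
  exists2 P : forall n : nat, probability (sgraph n) R,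
    forall n : nat, dependent_random_graph (p n) (d n) (P n) &
    exists2 eps : nat -> R, eps n @[n --> \oo] --> (0 : R) &
      P n [set G : sgraph n | exists A B : {set 'I_n},
            (edge_count G A B)%:R - p n * #|A|%:R * #|B|%:R
            > (1 - eps n) * (1 - p n) * Num.sqrt (1 - (d n)%:R / n%:R)
              * Num.sqrt (#|A|%:R * #|B|%:R * (n%:R * p n) * ((d n)%:R + 1))]
        @[n --> \oo] --> (1 : \bar R)%E.
Proof.
have p01' n : 0 <= p n <= 1 by case/andP: (p01 n) => -> /ltW.
pose P n := sval (cid2 (bundle_graph_exists n (d n) (p01' n))).
have Pdep n : dependent_random_graph (p n) (d n) (P n).
  by rewrite /P; case: cid2.
have Plow n : (d n < n)%N -> forall t : R, 0 < t ->
    ((1 - (n - (d n).+1)%:R * p n / t ^+ 2)%:E <=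
      P n [set G : sgraph n | exists A B : {set 'I_n},
           [/\ #|A| = (d n).+1, (p n * (n - (d n).+1)%:R - t < #|B|%:R)%R &
               (#|A| * #|B| <= edge_count G A B)%N]])%E.
  by rewrite /P; case: cid2.
(* A fourth root keeps all the scales integer powers: mean about [s ^+ 4], standard deviation at
   most [s ^+ 2], allowed deviation [s ^+ 3]. *)
pose s n := Num.sqrt (Num.sqrt ((n%:R - (d n)%:R) * p n)).
have soo : s n @[n --> \oo] --> +oo.
  do 2 apply: cvgr_sqrt_pinfty.
  (* From [d < 0.99 n] one gets [n - d > n / 100], hence the factor 100. *)
  apply/cvgryPge => B; move/cvgryPge : np_oo => /(_ (100 * B)).
  apply: filterS2 (nbhs_infty_gt 0) => n n0 hB.
  by have := d_lt n n0; case/andP: (p01 n) => p0 _; nra.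
have s_gt0 : \forall n \near \oo, 0 < s n by move/cvgryPgt : soo; exact.
have sV0 : (s n)^-1 @[n --> \oo] --> (0 : R).
  by apply/(gtr0_cvgV0 s_gt0).
exists P => //; exists (fun n => 2 / s n).
  by rewrite -[0](mulr0 (2 : R)); apply: cvgM => //; exact: cvg_cst.
(* With [t = s ^+ 3], the Chebyshev failure bound is at most [s ^+ 4 / s ^+ 6 = s ^- 2]. *)
apply: (@squeeze_cvge _ _ _ _ (fun n => (1 - ((s n)^-1) ^+ 2)%:E) _ (cst 1%E)).
- move/cvgryPge : soo => /(_ 2); apply: filterS2 (nbhs_infty_gt 0) => n n0 s2.
  have n0R : 0 < n%:R :> R by rewrite ltr0n.
  have dnR : (d n)%:R < n%:R :> R by have := d_lt n n0; lra.
  have dn : (d n < n)%N by rewrite -(ltr_nat R).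
  have s0 : 0 < s n by lra.
  have [p0 p1] := andP (p01 n).
  have s4 : s n ^+ 4 = (n%:R - (d n)%:R) * p n.
    by rewrite (exprM _ 2 2) sqr_sqrtr ?sqrtr_ge0// sqr_sqrtr// mulr_ge0//; lra.
  rewrite probability_le1// andbT.
  apply: (@le_trans _ _ (P n [set G : sgraph n | exists A B : {set 'I_n},
      [/\ #|A| = (d n).+1, (p n * (n - (d n).+1)%:R - s n ^+ 3 < #|B|%:R)%R &
          (#|A| * #|B| <= edge_count G A B)%N]])).
    apply: le_trans (Plow n dn _ (exprn_gt0 3 s0)).
    rewrite lee_fin lerB// exprVn ler_pdivrMr ?exprn_gt0//.
    have -> : s n ^- 2 * (s n ^+ 3) ^+ 2 = s n ^+ 4 by field; lra.
    by rewrite s4 natrB// -[(d n).+1%:R]natr1; nra.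
  apply: le_measure; rewrite ?inE// => G [A [B [cA hB hG]]].
  exists A, B; rewrite cA -[(d n).+1%:R]natr1; apply: deviation_bound => //.
    by move: hB; rewrite natrB// -[(d n).+1%:R]natr1.
  by rewrite natr1 -cA -natrM ler_nat.
- apply/fine_cvgP; split; first exact: nearW.
  rewrite [X in _ --> X](_ : _ = 1 - 0 * 0 :> R); last by rewrite mul0r subr0.
  apply: cvgB; first exact: cvg_cst.
  by under eq_fun do rewrite expr2; exact: cvgM.
- exact: cvg_cst.
Qed.
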